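(* Let $A=\Pi_Q(k)$ for $Q=\widetilde{A_{n-1}}$. The graded automorphism group $\operatorname{Aut}_{\mathrm{gr}}(A)$ is isomorphic to a semidirect product $D_{2n}\ltimes N$, where $N=\{g\in\operatorname{Aut}_{\mathrm{gr}}(A)\mid g(e_i)=e_i\text{ for }i=1,\dots,n\}$ is the normal factor and $D_{2n}$ denotes the dihedral group of order $2n$.
   Context: $k$ is an algebraically closed field of characteristic $0$. Let $n\ge 3$ and let $Q=\widetilde{A_{n-1}}$ be the quiver with vertices $e_1,\dots,e_n$ and one arrow $\alpha_i$ from $e_i$ to $e_{i+1}$ for each $i=1,\dots,n$ (indices modulo $n$). Its double $\bar Q$ has the same vertices, the arrows $\alpha_i$, and additional arrows $\alpha_i^\ast$ from $e_{i+1}$ to $e_i$. Paths are composed left to right, and $e_i$ also denotes the trivial path at the vertex $e_i$. The preprojective algebra is $A=\Pi_Q(k)=k\bar Q/\left(\sum_i\alpha_i\alpha_i^\ast-\sum_i\alpha_i^\ast\alpha_i\right)$, i.e. $k\bar Q$ modulo the relations $\alpha_i\alpha_i^\ast=\alpha_{i-1}^\ast\alpha_{i-1}$, graded by path length. $\operatorname{Aut}_{\mathrm{gr}}(A)$ is the group of $k$-algebra automorphisms $g$ of $A$ with $g(A_j)=A_j$ for all $j$. *)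

(* Defs.v *)
From HB Require Import structures.
From mathcomp Require Import all_boot all_algebra all_fingroup all_solvable.
From mathcomp Require Import boolp classical_sets finmap monalg generic_quotient.

Set Implicit Arguments.
Unset Strict Implicit.
Unset Printing Implicit Defensive.

Import GRing.Theory.

Local Open Scope ring_scope.
Local Open Scope quotient_scope.

(* The vertex set is required to be non-empty because MathComp's algebras     *)
(* satisfy 1 != 0.                                                            *)
Record quiver := Quiver {
  qvert : finType;
  qarr : finType;
  qsrc : qarr -> qvert;
  qtgt : qarr -> qvert;
  qvert_gt0 : (0 < #|qvert|)%N
}.

Section Paths.
Variable Q : quiver.

(* s is a path starting at v, read from left to right. *)
Fixpoint is_path (v : qvert Q) (s : seq (qarr Q)) : bool :=
  if s is a :: s' then (qsrc a == v) && is_path (qtgt a) s' else true.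

(* A path is its source and its list of arrows, so that trivial paths at      *)
(* different vertices differ.                                                 *)
Definition qpath := {p : qvert Q * seq (qarr Q) | is_path p.1 p.2}.
HB.instance Definition _ := Choice.on qpath.

Definition psrc (p : qpath) : qvert Q := (val p).1.
Definition parrs (p : qpath) : seq (qarr Q) := (val p).2.
Definition ptgt (p : qpath) : qvert Q := last (psrc p) (map (@qtgt Q) (parrs p)).
Definition plen (p : qpath) : nat := size (parrs p).

Definition ptriv (v : qvert Q) : qpath := exist _ (v, [::]) isT.

Fact parrow_subproof (a : qarr Q) : is_path (qsrc a) [:: a].
Proof. by rewrite /= eqxx. Qed.
Definition parrow (a : qarr Q) : qpath := exist _ (qsrc a, [:: a]) (parrow_subproof a).

(* "p, then q"; None when p does not end where q starts. *)
Definition pathcomp (p q : qpath) : option qpath :=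
  if ptgt p == psrc q then insub (psrc p, parrs p ++ parrs q) : option qpath
  else None.

Lemma is_path_cat v s t :
  is_path v (s ++ t) = is_path v s && is_path (last v (map (@qtgt Q) s)) t.
Proof. by elim: s v => //= a s IHs v; rewrite IHs andbA. Qed.

Lemma is_path_last v s t (w := last v (map (@qtgt Q) s)) :
  last v (map (@qtgt Q) (s ++ t)) = last w (map (@qtgt Q) t).
Proof. by rewrite map_cat last_cat. Qed.

Lemma pathcompP p q :
  if ptgt p == psrc q then
    exists r, [/\ pathcomp p q = Some r, val r = (psrc p, parrs p ++ parrs q),
                  psrc r = psrc p & ptgt r = ptgt q]
  else pathcomp p q = None.
Proof.
rewrite /pathcomp; case: eqP => // e.
have pq : is_path (psrc p, parrs p ++ parrs q).1 (psrc p, parrs p ++ parrs q).2.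
  by rewrite /= is_path_cat; rewrite (valP p) /= -/(ptgt p) e; exact: (valP q).
case: insubP => [r _ er|]; last by rewrite pq.
exists r; split=> //; first by rewrite /psrc er.
by rewrite /ptgt /psrc /parrs er /= is_path_last -/(ptgt p) e.
Qed.

Lemma pathcompA p q r :
  obind (pathcomp p) (pathcomp q r) = obind (fun s => pathcomp s r) (pathcomp p q).
Proof.
have := pathcompP p q; have := pathcompP q r.
case: eqP => [e1 [s [-> vs ss ts]]|n1 ->]; case: eqP => [e2 [u [-> vu su tu]]|n2 ->] //=.
- have := pathcompP p s; have := pathcompP u r; rewrite tu ss e1 e2 !eqxx.
  move=> [x [-> vx _ _]] [y [-> vy _ _]]; congr Some; apply: val_inj.
  rewrite vx vy su; congr (_, _).
  have -> : parrs s = parrs q ++ parrs r by rewrite {1}/parrs vs.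
  by have -> : parrs u = parrs p ++ parrs q; rewrite ?catA // {1}/parrs vu.
- have := pathcompP p s; rewrite ss; case: eqP => // e; congruence.
have := pathcompP u r; rewrite tu; case: eqP => // e; congruence.
Qed.

Lemma pathcomp1p v p : pathcomp (ptriv v) p = if v == psrc p then Some p else None.
Proof.
have := pathcompP (ptriv v) p; rewrite /ptgt/=; case: eqP => // -> [r [-> vr _ _]].
congr Some; apply: val_inj; apply: etrans vr _; rewrite /psrc /parrs /=.
by case: (sval p).
Qed.

Lemma pathcompp1 v p : pathcomp p (ptriv v) = if ptgt p == v then Some p else None.
Proof.
have := pathcompP p (ptriv v); rewrite -[psrc (ptriv v)]/v.
case: (ptgt p == v) => // -[r [-> vr _ _]].
congr Some; apply: val_inj; apply: etrans vr _; rewrite /psrc /parrs /= cats0.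
by case: (sval p).
Qed.

Lemma pathcomp_triv p q v :
  (pathcomp p q == Some (ptriv v)) = (p == ptriv v) && (q == ptriv v).
Proof.
apply/eqP/andP => [|[/eqP-> /eqP->]]; last by rewrite pathcomp1p eqxx.
have := pathcompP p q; case: eqP => [e [r [-> vr _ _]] [er]|n -> //].
move: vr; rewrite er => -[ev /esym/eqP]; rewrite -size_eq0 size_cat addn_eq0.
case/andP => /nilP ps /nilP qs; move: e; rewrite /ptgt ps /= => e.
have qpathE (u : qpath) : val u = (psrc u, parrs u) by rewrite -surjective_pairing.
by split; apply/eqP/val_inj; apply: etrans (qpathE _) _; rewrite ?ps ?qs -?e -ev.
Qed.

End Paths.

(* {malg k[qpath Q]} is the k-vector space on the basis qpath Q; as qpath Q   *)
(* is not a monoid, malg provides no product on it. The operations of malg    *)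
(* are sealed, as unification would otherwise unfold finitely supported maps. *)
Definition pathalg (k : fieldType) (Q : quiver) := {malg k[qpath Q]}.
HB.instance Definition _ k Q := Choice.on (pathalg k Q).

HB.lock Definition pathalg_zero (k : fieldType) (Q : quiver) : pathalg k Q :=
  (0 : {malg k[qpath Q]}).
HB.lock Definition pathalg_opp (k : fieldType) (Q : quiver) (f : pathalg k Q) :
  pathalg k Q := - (f : {malg k[qpath Q]}).
HB.lock Definition pathalg_add (k : fieldType) (Q : quiver) (f g : pathalg k Q) :
  pathalg k Q := (f : {malg k[qpath Q]}) + (g : {malg k[qpath Q]}).
HB.lock Definition pathalg_scale (k : fieldType) (Q : quiver) (c : k)
  (f : pathalg k Q) : pathalg k Q := c *: (f : {malg k[qpath Q]}).

Section PathSpace.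
Variables (k : fieldType) (Q : quiver).
Local Notation kQ := (pathalg k Q).
Local Notation "f +' g" := (pathalg_add f g) (at level 50).

Lemma pathalgP (f g : kQ) : (forall p, f@_p = g@_p) <-> f = g.
Proof. exact: malgP. Qed.

Let coef0 p : (@pathalg_zero k Q)@_p = 0.
Proof. by rewrite pathalg_zero.unlock mcoeff0. Qed.
Let coefN (f : kQ) p : (pathalg_opp f)@_p = - f@_p.
Proof. by rewrite pathalg_opp.unlock mcoeffN. Qed.
Let coefD (f g : kQ) p : (f +' g)@_p = f@_p + g@_p.
Proof. by rewrite pathalg_add.unlock mcoeffD. Qed.
Let coefZ c (f : kQ) p : (pathalg_scale c f)@_p = c * f@_p.
Proof. by rewrite pathalg_scale.unlock mcoeffZ. Qed.

Fact pathalg_addA : associative (@pathalg_add k Q).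
Proof. by move=> f g h; apply/pathalgP => p; rewrite !coefD addrA. Qed.
Fact pathalg_addC : commutative (@pathalg_add k Q).
Proof. by move=> f g; apply/pathalgP => p; rewrite !coefD addrC. Qed.
Fact pathalg_add0 : left_id (@pathalg_zero k Q) (@pathalg_add k Q).
Proof. by move=> f; apply/pathalgP => p; rewrite coefD coef0 add0r. Qed.
Fact pathalg_addN :
  left_inverse (@pathalg_zero k Q) (@pathalg_opp k Q) (@pathalg_add k Q).
Proof. by move=> f; apply/pathalgP => p; rewrite coefD coefN coef0 addNr. Qed.
HB.instance Definition _ := GRing.isZmodule.Build kQ
  pathalg_addA pathalg_addC pathalg_add0 pathalg_addN.

Fact pathalg_scaleA c d (f : kQ) :
  pathalg_scale c (pathalg_scale d f) = pathalg_scale (c * d) f.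
Proof. by apply/pathalgP => p; rewrite !coefZ mulrA. Qed.
Fact pathalg_scale1 : left_id 1 (@pathalg_scale k Q).
Proof. by move=> f; apply/pathalgP => p; rewrite coefZ mul1r. Qed.
Fact pathalg_scaleDr : right_distributive (@pathalg_scale k Q) +%R.
Proof.
by move=> c f g; apply/pathalgP => p; rewrite coefZ !coefD mulrDr -!coefZ.
Qed.
Fact pathalg_scaleDl (f : kQ) : {morph (@pathalg_scale k Q)^~ f : c d / c + d}.
Proof.
by move=> c d; apply/pathalgP => p; rewrite coefD !coefZ mulrDl.
Qed.
HB.instance Definition _ := GRing.Zmodule_isLmodule.Build k kQ
  pathalg_scaleA pathalg_scale1 pathalg_scaleDr pathalg_scaleDl.

End PathSpace.

HB.lock Definition pbase (k : fieldType) (Q : quiver) (p : qpath Q) : pathalg k Q :=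
  << p >>.

(* The product of two basis paths: left-to-right concatenation, or 0. *)
HB.lock Definition bmul (k : fieldType) (Q : quiver) (p q : qpath Q) : pathalg k Q :=
  if pathcomp p q is Some r then pbase k r else 0.

HB.lock Definition pathalg_mul (k : fieldType) (Q : quiver) (f g : pathalg k Q) :
    pathalg k Q :=
  \sum_(p <- msupp f) \sum_(q <- msupp g) (f@_p * g@_q) *: bmul k p q.

HB.lock Definition pathalg_one (k : fieldType) (Q : quiver) : pathalg k Q :=
  \sum_v pbase k (ptriv v).

Section PathAlgebra.
Variables (k : fieldType) (Q : quiver).
Local Notation kQ := (pathalg k Q).
Local Notation pbase := (@pbase k Q).
Local Notation bmul := (@bmul k Q).
Local Notation pathalg_mul := (@pathalg_mul k Q).
Local Notation pathalg_one := (@pathalg_one k Q).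

Local Notation "f *' g" := (pathalg_mul f g) (at level 40, left associativity).

Lemma bmulE p q : bmul p q = if pathcomp p q is Some r then pbase r else 0.
Proof. by rewrite bmul.unlock. Qed.

Definition coef (p : qpath Q) (f : kQ) : k := f@_p.

Fact coef_linear p : linear_for *%R (coef p).
Proof.
move=> c f g; rewrite /coef [RHS]/=.
have -> : (c *: f + g : kQ) = pathalg_add (pathalg_scale c f) g by [].
by rewrite pathalg_add.unlock pathalg_scale.unlock mcoeffD mcoeffZ.
Qed.
HB.instance Definition _ p := GRing.isLinear.Build k kQ k _ (coef p) (coef_linear p).

Lemma coefP (f g : kQ) : (forall p, coef p f = coef p g) <-> f = g.
Proof. exact: malgP. Qed.

Lemma coef_outdom (f : kQ) p : p \notin msupp f -> coef p f = 0.
Proof. exact: mcoeff_outdom. Qed.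

Lemma coef_base p q : coef q (pbase p) = (p == q)%:R.
Proof. by rewrite pbase.unlock /coef mcoeffU. Qed.

Lemma pathalgE (f : kQ) : f = \sum_(p <- msupp f) coef p f *: pbase p.
Proof.
apply/coefP => q; rewrite linear_sum /=.
under eq_bigr => p _ do rewrite linearZ /= coef_base.
have [qf|/[dup] qf /coef_outdom ->] := boolP (q \in msupp f).
  rewrite (big_fsetD1 q) //= eqxx mulr1 big1_fset ?addr0 // => p.
  by rewrite !inE => /andP[/negPf-> _] _; rewrite mulr0.
rewrite big1_fset // => p pf _; case: eqP => [e|]; last by rewrite mulr0.
by rewrite e (negPf qf) in pf.
Qed.

Lemma pathalg_ind (P : kQ -> Prop) :
    P 0 -> (forall c p f, P f -> P (c *: pbase p + f)) -> forall f, P f.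
Proof.
move=> P0 PD f; rewrite [f]pathalgE.
by elim/big_rec: _ => // p g _; apply: PD.
Qed.

Lemma pmulEw (d1 d2 : {fset qpath Q}) (f g : kQ) :
    (msupp f `<=` d1)%fset -> (msupp g `<=` d2)%fset ->
  f *' g = \sum_(p <- d1) \sum_(q <- d2) (coef p f * coef q g) *: bmul p q.
Proof.
move=> le1 le2; rewrite pathalg_mul.unlock (big_fset_incl _ le1) /=.
  apply: eq_bigr => p _; apply: big_fset_incl => // q _ /mcoeff_outdom ->.
  by rewrite mulr0 scale0r.
by move=> p _ /mcoeff_outdom fp; rewrite big1 // => q _; rewrite fp mul0r scale0r.
Qed.

Lemma pmulDl : left_distributive pathalg_mul +%R.
Proof.
move=> f g h; set d := (msupp f `|` msupp g `|` msupp (f + g : kQ))%fset.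
have leh := fsubset_refl (msupp h).
have lef : (msupp f `<=` d)%fset by rewrite /d -fsetUA fsubsetUl.
have leg : (msupp g `<=` d)%fset by rewrite /d (fsetUC (msupp f)) -fsetUA fsubsetUl.
have lefg : (msupp (f + g : kQ) `<=` d)%fset by rewrite /d fsubsetUr.
rewrite (pmulEw lefg leh) (pmulEw lef leh) (pmulEw leg leh).
rewrite -big_split; apply: eq_bigr => p _; rewrite -big_split; apply: eq_bigr => q _.
by rewrite linearD mulrDl scalerDl.
Qed.

Lemma pmulDr : right_distributive pathalg_mul +%R.
Proof.
move=> h f g; set d := (msupp f `|` msupp g `|` msupp (f + g : kQ))%fset.
have leh := fsubset_refl (msupp h).
have lef : (msupp f `<=` d)%fset by rewrite /d -fsetUA fsubsetUl.
have leg : (msupp g `<=` d)%fset by rewrite /d (fsetUC (msupp f)) -fsetUA fsubsetUl.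
have lefg : (msupp (f + g : kQ) `<=` d)%fset by rewrite /d fsubsetUr.
rewrite (pmulEw leh lefg) (pmulEw leh lef) (pmulEw leh leg).
rewrite -big_split; apply: eq_bigr => p _; rewrite -big_split; apply: eq_bigr => q _.
by rewrite linearD mulrDr scalerDl.
Qed.

Lemma pmulZl c f g : (c *: f) *' g = c *: (f *' g).
Proof.
set d := (msupp f `|` msupp (c *: f : kQ))%fset.
have leg := fsubset_refl (msupp g).
rewrite (pmulEw (fsubsetUl _ _ : msupp f `<=` d)%fset leg).
rewrite (pmulEw (fsubsetUr _ _ : msupp (c *: f : kQ) `<=` d)%fset leg).
rewrite scaler_sumr; apply: eq_bigr => p _.
rewrite scaler_sumr; apply: eq_bigr => q _.
by rewrite linearZ scalerA mulrA.
Qed.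

Lemma pmulZr c f g : f *' (c *: g) = c *: (f *' g).
Proof.
set d := (msupp g `|` msupp (c *: g : kQ))%fset.
have lef := fsubset_refl (msupp f).
rewrite (pmulEw lef (fsubsetUl _ _ : msupp g `<=` d)%fset).
rewrite (pmulEw lef (fsubsetUr _ _ : msupp (c *: g : kQ) `<=` d)%fset).
rewrite scaler_sumr; apply: eq_bigr => p _.
rewrite scaler_sumr; apply: eq_bigr => q _.
by rewrite linearZ scalerA mulrCA.
Qed.

Lemma pmul0l f : 0 *' f = 0.
Proof. by rewrite -(scale0r (0 : kQ)) pmulZl !scale0r. Qed.

Lemma pmul0r f : f *' 0 = 0.
Proof. by rewrite -(scale0r (0 : kQ)) pmulZr !scale0r. Qed.

Lemma pmul_base p q : pbase p *' pbase q = bmul p q.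
Proof.
have le_base r : (msupp (pbase r) `<=` [fset r])%fset by rewrite pbase.unlock msuppU_le.
rewrite (pmulEw (le_base p) (le_base q)).
by rewrite !big_seq_fset1 !coef_base !eqxx mulr1 scale1r.
Qed.

Lemma pmul_bmull p q r :
  bmul p q *' pbase r =
  if obind (fun s => pathcomp s r) (pathcomp p q) is Some s then pbase s else 0.
Proof. by rewrite bmulE; case: (pathcomp p q) => [s|] /=; rewrite ?pmul0l // pmul_base bmulE. Qed.

Lemma pmul_bmulr p q r :
  pbase p *' bmul q r =
  if obind (pathcomp p) (pathcomp q r) is Some s then pbase s else 0.
Proof. by rewrite bmulE; case: (pathcomp q r) => [s|] /=; rewrite ?pmul0r // pmul_base bmulE. Qed.

Lemma pmulA : associative pathalg_mul.
Proof.
move=> f g h; elim/pathalg_ind: f => [|c p f IHf]; first by rewrite !pmul0l.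
rewrite !pmulDl -IHf !pmulZl; congr (_ *: _ + _).
elim/pathalg_ind: g {IHf} => [|d q g IHg]; first by rewrite !(pmul0l, pmul0r).
rewrite !(pmulDl, pmulDr) IHg !(pmulZl, pmulZr); congr (_ *: _ + _).
elim/pathalg_ind: h {IHg} => [|e r h IHh]; first by rewrite !pmul0r.
rewrite !pmulDr IHh !pmulZr; congr (_ *: _ + _).
by rewrite !pmul_base pmul_bmull pmul_bmulr pathcompA.
Qed.

Lemma pmul1l : left_id pathalg_one pathalg_mul.
Proof.
move=> f; elim/pathalg_ind: f => [|c p f IHf]; first exact: pmul0r.
rewrite pmulDr IHf pmulZr; congr (_ *: _ + _).
rewrite pathalg_one.unlock (big_morph (pathalg_mul^~ _) (fun _ _ => pmulDl _ _ _) (pmul0l _)).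
rewrite (bigD1 (psrc p)) //= pmul_base bmulE pathcomp1p eqxx big1 ?addr0 // => v vp.
by rewrite pmul_base bmulE pathcomp1p (negPf vp).
Qed.

Lemma pmul1r : right_id pathalg_one pathalg_mul.
Proof.
move=> f; elim/pathalg_ind: f => [|c p f IHf]; first exact: pmul0l.
rewrite pmulDl IHf pmulZl; congr (_ *: _ + _).
rewrite pathalg_one.unlock (big_morph (pathalg_mul _) (fun _ _ => pmulDr _ _ _) (pmul0r _)).
rewrite (bigD1 (ptgt p)) //= pmul_base bmulE pathcompp1 eqxx big1 ?addr0 // => v vp.
by rewrite pmul_base bmulE pathcompp1 eq_sym (negPf vp).
Qed.

Lemma coef_one_triv v : coef (ptriv v) pathalg_one = 1.
Proof.
rewrite pathalg_one.unlock linear_sum /= (bigD1 v) //= coef_base eqxx big1 ?addr0 //.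
move=> w wv; rewrite coef_base; case: eqP => // /(congr1 val) [e].
by rewrite e eqxx in wv.
Qed.

Lemma pathalg_one_neq0 : pathalg_one != 0.
Proof.
have /card_gt0P[v _] := qvert_gt0 Q; apply/eqP => e.
by have := coef_one_triv v; rewrite e linear0 => /eqP; rewrite eq_sym oner_eq0.
Qed.

HB.instance Definition _ := GRing.Zmodule_isNzRing.Build kQ
  pmulA pmul1l pmul1r pmulDl pmulDr pathalg_one_neq0.

Fact pathalg_scaleAl (c : k) (f g : kQ) : c *: (f * g) = c *: f * g.
Proof. by rewrite [RHS]pmulZl. Qed.
HB.instance Definition _ := GRing.Lmodule_isLalgebra.Build k kQ pathalg_scaleAl.

Fact pathalg_scaleAr (c : k) (f g : kQ) : c *: (f * g) = f * (c *: g).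
Proof. by rewrite [RHS]pmulZr. Qed.
HB.instance Definition _ := GRing.Lalgebra_isAlgebra.Build k kQ pathalg_scaleAr.

Lemma pbaseM p q : pbase p * pbase q = if pathcomp p q is Some r then pbase r else 0.
Proof. by rewrite [LHS]pmul_base bmulE. Qed.

Lemma coefM_triv (f g : kQ) v :
  coef (ptriv v) (f * g) = coef (ptriv v) f * coef (ptriv v) g.
Proof.
elim/pathalg_ind: f => [|c p f IHf]; first by rewrite mul0r !linear0 mul0r.
rewrite mulrDl !linearD /= IHf mulrDl -scalerAl !linearZ /= -mulrA; congr (_ * _ + _).
elim/pathalg_ind: g {IHf} => [|d q g IHg]; first by rewrite mulr0 !linear0 mulr0.
rewrite mulrDr !linearD /= IHg mulrDr -scalerAr !linearZ /= (mulrCA (coef _ (pbase p))); congr (_ * _ + _).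
rewrite pbaseM !coef_base -natrM mulnb -pathcomp_triv.
by case: (pathcomp p q) => [r|]; rewrite ?coef_base ?linear0.
Qed.

End PathAlgebra.

(* inl a is the arrow a of Q, and inr a the opposite arrow a^*. *)
Definition double_quiver (Q : quiver) : quiver := @Quiver
  (qvert Q) (qarr Q + qarr Q)%type
  (fun a => match a with inl b => qsrc b | inr b => qtgt b end)
  (fun a => match a with inl b => qtgt b | inr b => qsrc b end)
  (qvert_gt0 Q).

Section Preprojective.
Variables (k : fieldType) (Q : quiver).
Local Notation kQQ := (pathalg k (double_quiver Q)).

Definition darrow (a : qarr Q) : kQQ :=
  pbase k (@parrow (double_quiver Q) (inl a)).
Definition darrow_star (a : qarr Q) : kQQ :=
  pbase k (@parrow (double_quiver Q) (inr a)).

Definition preproj_rel : kQQ :=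
  \sum_a darrow a * darrow_star a - \sum_a darrow_star a * darrow a.

(* The two-sided ideal generated by preproj_rel. *)
Definition preproj_ideal : {pred kQQ} := fun f =>
  `[< exists s : seq (kQQ * kQQ), f = \sum_(uv <- s) uv.1 * preproj_rel * uv.2 >].

Lemma preproj_idealP f :
  reflect (exists s : seq (kQQ * kQQ), f = \sum_(uv <- s) uv.1 * preproj_rel * uv.2)
          (f \in preproj_ideal).
Proof. exact: asboolP. Qed.

Fact preproj_ideal_zmod_closed : zmod_closed preproj_ideal.
Proof.
split=> [|f g /preproj_idealP[s ->] /preproj_idealP[t ->]]; apply/preproj_idealP.
  by exists [::]; rewrite big_nil.
exists (s ++ [seq (- uv.1, uv.2) | uv <- t]).
by rewrite big_cat big_map -sumrN; congr (_ + _); apply: eq_bigr => uv _; rewrite !mulNr.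
Qed.
HB.instance Definition _ := GRing.isZmodClosed.Build _ preproj_ideal
  preproj_ideal_zmod_closed.

Lemma preproj_idealMl f g : g \in preproj_ideal -> f * g \in preproj_ideal.
Proof.
move=> /preproj_idealP[s ->]; apply/preproj_idealP.
exists [seq (f * uv.1, uv.2) | uv <- s]; rewrite big_map mulr_sumr.
by apply: eq_bigr => uv _; rewrite !mulrA.
Qed.

Lemma preproj_idealMr f g : f \in preproj_ideal -> f * g \in preproj_ideal.
Proof.
move=> /preproj_idealP[s ->]; apply/preproj_idealP.
exists [seq (uv.1, uv.2 * g) | uv <- s]; rewrite big_map mulr_suml.
by apply: eq_bigr => uv _; rewrite !mulrA.
Qed.

Lemma preproj_idealZ c f : f \in preproj_ideal -> c *: f \in preproj_ideal.
Proof. by move=> If; rewrite -[f]mul1r scalerAl; apply: preproj_idealMl. Qed.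

Lemma preproj_ideal1 : 1 \notin preproj_ideal.
Proof.
have /card_gt0P[v _] := qvert_gt0 (double_quiver Q).
apply/preproj_idealP => -[s /(congr1 (coef (ptriv v)))].
have arrow0 b : coef (ptriv v) (pbase k (@parrow (double_quiver Q) b)) = 0.
  by rewrite coef_base; case: eqP => // /(congr1 val).
rewrite [LHS]coef_one_triv linear_sum /= big1 => [/eqP|uv _]; first by rewrite oner_eq0.
rewrite !coefM_triv /preproj_rel linearB !linear_sum /= !big1 ?subr0 ?mulr0 ?mul0r //.
  by move=> a _; rewrite coefM_triv arrow0 mul0r.
by move=> a _; rewrite coefM_triv arrow0 mul0r.
Qed.

Definition preproj := Quotient.quot preproj_ideal.
HB.instance Definition _ := GRing.Zmodule.on preproj.
HB.instance Definition _ := EqQuotient.on preproj.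

Definition preproj_pi (f : kQQ) : preproj := \pi_preproj f.

Lemma preproj_piP f g : reflect (preproj_pi f = preproj_pi g) (f - g \in preproj_ideal).
Proof. by rewrite Quotient.idealrBE; apply: eqP. Qed.

Lemma preproj_piK (x : preproj) : preproj_pi (repr x) = x.
Proof. exact: reprK. Qed.

Lemma preproj_piD f g : preproj_pi (f + g) = preproj_pi f + preproj_pi g.
Proof. exact: Quotient.pi_add. Qed.

End Preprojective.

HB.lock Definition preproj_mul (k : fieldType) (Q : quiver) (x y : preproj k Q) :
  preproj k Q := preproj_pi (repr x * repr y).
HB.lock Definition preproj_scale (k : fieldType) (Q : quiver) (c : k)
  (x : preproj k Q) : preproj k Q := preproj_pi (c *: repr x).

Section PreprojectiveAlgebra.
Variables (k : fieldType) (Q : quiver).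
Local Notation kQQ := (pathalg k (double_quiver Q)).
Local Notation preproj := (preproj k Q).
Local Notation preproj_mul := (@preproj_mul k Q).
Local Notation preproj_scale := (@preproj_scale k Q).
Local Notation preproj_pi := (@preproj_pi k Q).
Local Notation preproj_ideal := (@preproj_ideal k Q).

Lemma preproj_piM f g : preproj_pi (f * g) = preproj_mul (preproj_pi f) (preproj_pi g).
Proof.
rewrite preproj_mul.unlock; apply/preproj_piP; set f' := repr _; set g' := repr _.
have -> : f * g - f' * g' = (f - f') * g + f' * (g - g').
  by rewrite mulrBl mulrBr addrA subrK.
apply: rpredD; [apply: preproj_idealMr|apply: preproj_idealMl];
by apply/preproj_piP; rewrite preproj_piK.
Qed.

Lemma preproj_piZ c f : preproj_pi (c *: f) = preproj_scale c (preproj_pi f).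
Proof.
rewrite preproj_scale.unlock; apply/preproj_piP; rewrite -scalerBr; apply: preproj_idealZ.
by apply/preproj_piP; rewrite preproj_piK.
Qed.

Lemma preproj_ind (P : preproj -> Prop) : (forall f, P (preproj_pi f)) -> forall x, P x.
Proof. by move=> Ppi x; rewrite -[x]preproj_piK. Qed.

Fact preproj_mulA : associative preproj_mul.
Proof.
move=> x y z; elim/preproj_ind: x => f; elim/preproj_ind: y => g.
by elim/preproj_ind: z => h; rewrite -!preproj_piM mulrA.
Qed.

Fact preproj_mul1l : left_id (preproj_pi 1) preproj_mul.
Proof. by elim/preproj_ind => f; rewrite -preproj_piM mul1r. Qed.

Fact preproj_mul1r : right_id (preproj_pi 1) preproj_mul.
Proof. by elim/preproj_ind => f; rewrite -preproj_piM mulr1. Qed.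

Fact preproj_mulDl : left_distributive preproj_mul +%R.
Proof.
move=> x y z; elim/preproj_ind: x => f; elim/preproj_ind: y => g.
elim/preproj_ind: z => h.
by rewrite -!(preproj_piM, preproj_piD) mulrDl.
Qed.

Fact preproj_mulDr : right_distributive preproj_mul +%R.
Proof.
move=> x y z; elim/preproj_ind: x => f; elim/preproj_ind: y => g.
elim/preproj_ind: z => h.
by rewrite -!(preproj_piM, preproj_piD) mulrDr.
Qed.

Fact preproj_one_neq0 : preproj_pi 1 != 0.
Proof.
apply/eqP => e; have := preproj_ideal1 k Q; rewrite -[1]subr0 => /preproj_piP[].
by rewrite e; apply: (addrI (preproj_pi 0)); rewrite -preproj_piD !addr0.
Qed.

HB.instance Definition _ := GRing.Zmodule_isNzRing.Build preproj
  preproj_mulA preproj_mul1l preproj_mul1r preproj_mulDl preproj_mulDr preproj_one_neq0.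

Fact preproj_scaleA c d x :
  preproj_scale c (preproj_scale d x) = preproj_scale (c * d) x.
Proof. by elim/preproj_ind: x => f; rewrite -!preproj_piZ scalerA. Qed.

Fact preproj_scale1 : left_id 1 preproj_scale.
Proof. by elim/preproj_ind => f; rewrite -preproj_piZ scale1r. Qed.

Fact preproj_scaleDr : right_distributive preproj_scale +%R.
Proof.
move=> c x y; elim/preproj_ind: x => f; elim/preproj_ind: y => g.
by rewrite -!(preproj_piZ, preproj_piD) scalerDr.
Qed.

Fact preproj_scaleDl x : {morph preproj_scale^~ x : c d / c + d}.
Proof.
by move=> c d; elim/preproj_ind: x => f; rewrite -!(preproj_piZ, preproj_piD) scalerDl.
Qed.

HB.instance Definition _ := GRing.Zmodule_isLmodule.Build k preproj
  preproj_scaleA preproj_scale1 preproj_scaleDr preproj_scaleDl.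

Lemma preproj_pi_mul (f g : kQQ) : preproj_pi (f * g) = preproj_pi f * preproj_pi g.
Proof. exact: preproj_piM. Qed.
Lemma preproj_pi_scale c (f : kQQ) : preproj_pi (c *: f) = c *: preproj_pi f.
Proof. exact: preproj_piZ. Qed.

Fact preproj_scaleAl (c : k) (x y : preproj) : c *: (x * y) = c *: x * y.
Proof.
elim/preproj_ind: x => f; elim/preproj_ind: y => g.
by rewrite -!(preproj_pi_mul, preproj_pi_scale) scalerAl.
Qed.
HB.instance Definition _ := GRing.Lmodule_isLalgebra.Build k preproj preproj_scaleAl.

Fact preproj_scaleAr (c : k) (x y : preproj) : c *: (x * y) = x * (c *: y).
Proof.
elim/preproj_ind: x => f; elim/preproj_ind: y => g.
by rewrite -!(preproj_pi_mul, preproj_pi_scale) scalerAr.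
Qed.
HB.instance Definition _ := GRing.Lalgebra_isAlgebra.Build k preproj preproj_scaleAr.

Fact preproj_pi_linear : linear preproj_pi.
Proof. by move=> c f g; rewrite preproj_piD preproj_pi_scale. Qed.
HB.instance Definition _ := GRing.isLinear.Build k kQQ preproj _ preproj_pi
  preproj_pi_linear.

Fact preproj_pi_monoid : monoid_morphism preproj_pi.
Proof. by split=> // f g; apply: preproj_piM. Qed.
HB.instance Definition _ := GRing.isMonoidMorphism.Build kQQ preproj preproj_pi
  preproj_pi_monoid.

Definition videm (v : qvert Q) : preproj :=
  preproj_pi (pbase k (@ptriv (double_quiver Q) v)).

(* The image of the span of the paths of length j. *)
Definition homog_part (j : nat) : set preproj :=
  [set x : preproj | exists2 f : kQQ,
     (forall p, p \in msupp f -> plen p = j) & x = preproj_pi f]%classic.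

Definition is_graut (g : preproj -> preproj) : Prop :=
  [/\ linear g, monoid_morphism g, bijective g &
      forall j, (g @` homog_part j)%classic = homog_part j].

(* Underlies the group of graded automorphisms, with (g * h) x = g (h x). *)
Definition graut := {g : preproj -> preproj | `[< is_graut g >]}.
HB.instance Definition _ := Choice.on graut.

Lemma grautP (g : graut) : is_graut (val g).
Proof. exact: asboolW (valP g). Qed.

Fact graut_one_subproof : `[< is_graut id >].
Proof.
apply/asboolP; split=> // [|j]; first by exists id.
exact: image_id.
Qed.
Definition graut_one : graut := exist _ id graut_one_subproof.

Fact graut_mul_subproof (g h : graut) : `[< is_graut (val g \o val h) >].
Proof.
have [gl [g1 gM] gb gj] := grautP g; have [hl [h1 hM] hb hj] := grautP h.
apply/asboolP; split=> [c x y /=|||j].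
- by rewrite hl gl.
- by split=> [|x y] /=; rewrite ?h1 ?g1 // hM gM.
- exact: bij_comp.
- by rewrite -image_comp hj gj.
Qed.
Definition graut_mul (g h : graut) : graut :=
  exist _ (val g \o val h) (graut_mul_subproof g h).

Fact graut_inv_subproof (g : graut) :
  exists h : graut, cancel (val g) (val h) /\ cancel (val h) (val g).
Proof.
have [gl [g1 gM] [h gK hK] gj] := grautP g.
suff hP : `[< is_graut h >] by exists (exist _ h hP).
apply/asboolP; split=> [c x y|||j].
- by apply: (can_inj gK); rewrite gl !hK.
- by split=> [|x y]; apply: (can_inj gK); rewrite ?gM !hK.
- by exists (val g).
- rewrite -{1}(gj j) image_comp (_ : h \o val g = id) ?image_id //.
  by apply/funext => x /=; rewrite gK.
Qed.
Definition graut_inv (g : graut) : graut := sval (cid (graut_inv_subproof g)).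

Fact graut_mulA : associative graut_mul.
Proof. by move=> f g h; apply: val_inj. Qed.
Fact graut_mul1l : left_id graut_one graut_mul.
Proof. by move=> g; apply: val_inj. Qed.
Fact graut_mul1r : right_id graut_one graut_mul.
Proof. by move=> g; apply: val_inj. Qed.
Fact graut_mulVg : left_inverse graut_one graut_inv graut_mul.
Proof.
move=> g; apply: val_inj; apply/funext => x /=.
by rewrite /graut_inv; case: cid => h [gK hK] /=; rewrite gK.
Qed.
Fact graut_mulgV : right_inverse graut_one graut_inv graut_mul.
Proof.
move=> g; apply: val_inj; apply/funext => x /=.
by rewrite /graut_inv; case: cid => h [gK hK] /=; rewrite hK.
Qed.
HB.instance Definition _ := isGroup.Build graut
  graut_mulA graut_mul1l graut_mul1r graut_mulVg graut_mulgV.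

Definition fixes_idems : {pred graut} :=
  fun g => `[< forall v, val g (videm v) = videm v >].

Definition idem_stab := {g : graut | g \in fixes_idems}.
HB.instance Definition _ := SubChoice.on idem_stab.

Fact fixes_idems_group_closed : group_closed fixes_idems.
Proof.
split; first by apply/asboolP.
move=> g h /asboolP gv /asboolP hv; apply/asboolP => v.
have hVv : val h^-1%g (videm v) = videm v.
  by rewrite -{1}(hv v); have /(congr1 (fun u => val u (videm v))) := mulVg h.
by rewrite /= hVv gv.
Qed.
HB.instance Definition _ := SubChoice_isSubGroup.Build _ fixes_idems idem_stab
  fixes_idems_group_closed.

End PreprojectiveAlgebra.

Section SemidirectProduct.
Local Open Scope group_scope.

(* A left action of H on N by group automorphisms, i.e., a group homomorphism *)
(* from H to Aut(N).                                                          *)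
Record auto_action (H N : groupType) := AutAction {
  aut_action_fun :> H -> N -> N;
  aut_action1 : forall x, aut_action_fun 1 x = x;
  aut_actionM : forall a b x, aut_action_fun (a * b) x = aut_action_fun a (aut_action_fun b x);
  aut_action_morph : forall a, {morph aut_action_fun a : x y / x * y}
}.

(* The semidirect product of H and N, with N normal; (a, x) stands for the    *)
(* product of x in N and a in H, in this order.                               *)
Definition sdprod_of (H N : groupType) (th : auto_action H N) : Type := (H * N)%type.
HB.instance Definition _ H N (th : auto_action H N) := Choice.on (sdprod_of th).

Variables (H N : groupType) (th : auto_action H N).
Local Notation S := (sdprod_of th).

Definition sd_one : S := (1, 1).
Definition sd_mul (u v : S) : S := (u.1 * v.1, u.2 * th u.1 v.2).
Definition sd_inv (u : S) : S := (u.1^-1, th u.1^-1 u.2^-1).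

Lemma aut_action_one a : th a 1 = 1.
Proof. by apply: (mulgI (th a 1)); rewrite -aut_action_morph !mulg1. Qed.

Fact sd_mulA : associative sd_mul.
Proof. by move=> u v w; rewrite /sd_mul /= aut_actionM aut_action_morph !mulgA. Qed.
Fact sd_mul1l : left_id sd_one sd_mul.
Proof. by case=> a x; rewrite /sd_mul /= aut_action1 !mul1g. Qed.
Fact sd_mul1r : right_id sd_one sd_mul.
Proof. by case=> a x; rewrite /sd_mul /= aut_action_one !mulg1. Qed.
Fact sd_mulVg : left_inverse sd_one sd_inv sd_mul.
Proof. by case=> a x; rewrite /sd_mul /= -aut_action_morph !mulVg aut_action_one. Qed.
Fact sd_mulgV : right_inverse sd_one sd_inv sd_mul.
Proof. by case=> a x; rewrite /sd_mul /= -aut_actionM !mulgV aut_action1 mulgV. Qed.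
HB.instance Definition _ := isGroup.Build S
  sd_mulA sd_mul1l sd_mul1r sd_mulVg sd_mulgV.

End SemidirectProduct.

Fact card_Zn_gt0 n : (0 < #|'Z_n|)%N.
Proof. by rewrite card_ord. Qed.

(* The vertices are the integers mod n, and the arrow i goes from i to i + 1; *)
(* meaningful only for n > 1, as 'Z_n is otherwise the ring of integers mod 2 *)
Definition cyclic_quiver (n : nat) : quiver :=
  @Quiver 'Z_n 'Z_n id (fun i => i + 1) (card_Zn_gt0 n).

(* Main.v *)
(* A graded automorphism permutes the vertex idempotents, since the degree-0  *)
(* part is the product algebra on them, and it preserves adjacency of the     *)
(* vertices, since e_v A_1 e_w is non-zero exactly when v and w are joined by *)
(* an arrow of the double quiver. For n >= 3 this yields a homomorphism to    *)
(* the affine maps v |-> c +- v of Z/n, whose kernel is N. It splits:         *)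
(* these maps act on the double quiver, reflections exchanging the arrows     *)
(* a_i with arrows a_j^*, and the preprojective relation is preserved up to   *)
(* the sign of the map.                                                       *)
From HB Require Import structures.
Require Import Defs.
From mathcomp Require Import all_boot all_algebra all_fingroup all_solvable.
From mathcomp Require Import boolp classical_sets finmap generic_quotient.
From mathcomp Require Import ring.

Set Implicit Arguments.
Unset Strict Implicit.
Unset Printing Implicit Defensive.

Import GRing.Theory.

(** Let Aff be the group of maps v |-> c + v and v |-> c - v of Z/n, which is dihedral of order 2n
    ([dihedral_hom]). The claim is that restriction to the vertices gives a split extension of Aff
    by N. Restriction: the relation has degree 2, so the vertex coefficients descend to algebra
    characters of A. Composing them with a graded automorphism g shows that g permutes the e_v
    ([graut_vertex_perm]). Arrows are non-zero in A_1, so this permutation preserves adjacency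
    ([graut_arrow]). An injective map of Z/n whose steps are all +1 or -1 cannot turn back when n >=
    3, so it is affine ([cyclic_rigid]). Splitting: Aff acts on the double quiver and multiplies the
    relation by a sign ([dih_preproj_rel]), so it acts on A by graded automorphisms ([graut_act]),
    and faithfully on the vertices ([dih_act_faithful]). [sdprod_of_split] turns these facts into
    the semidirect product. *)

(* (c, e) stands for the affine map v |-> c + (-1)^e v of Z/n. *)
Definition dih (n : nat) : Type := ('Z_n * bool)%type.
HB.instance Definition _ n := Finite.on (dih n).

(** * The group of affine maps of Z/n, and its dihedral structure *)

Section DihedralGroup.
Variable n : nat.
Local Open Scope ring_scope.

Definition dih_act (u : dih n) (v : 'Z_n) : 'Z_n := u.1 + (-1) ^+ u.2 * v.
Definition dih_mul (u w : dih n) : dih n := (dih_act u w.1, u.2 (+) w.2).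
Definition dih_one : dih n := (0, false).
Definition dih_inv (u : dih n) : dih n := (- ((-1) ^+ u.2 * u.1), u.2).

Lemma dih_actM u w v : dih_act (dih_mul u w) v = dih_act u (dih_act w v).
Proof. by rewrite /dih_act /= mulrDr signr_addb mulrA addrA. Qed.

Lemma dih_act1 v : dih_act dih_one v = v.
Proof. by rewrite /dih_act /= add0r mul1r. Qed.

Fact dih_mulA : associative dih_mul.
Proof.
by move=> u v w; congr (_, _); [rewrite /= dih_actM | rewrite /= addbA].
Qed.

Fact dih_mul1 : left_id dih_one dih_mul.
Proof. by case=> c e; rewrite /dih_mul /= dih_act1. Qed.

Fact dih_mulV : left_inverse dih_one dih_inv dih_mul.
Proof. by case=> c e; rewrite /dih_mul /dih_act /= addNr addbb. Qed.

HB.instance Definition _ := Finite_isGroup.Build (dih n)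
  dih_mulA dih_mul1 dih_mulV.

End DihedralGroup.

Section DihedralIso.
Variables (n : nat) (n_gt1 : (1 < n)%N).
Local Open Scope group_scope.

Local Notation s := ((0%R, true) : dih n).
Local Notation t := ((1%R, true) : dih n).

Lemma dih_reflection_order (c : 'Z_n) : #[(c, true) : dih n] = 2%N.
Proof.
apply: nt_prime_order; rewrite // ?xpair_eqE ?andbF //.
by congr (_, _); rewrite /= /dih_act /= mulN1r subrr.
Qed.

Lemma dih_rotationX k : ((1%R, false) : dih n) ^+ k = (k%:R%R, false).
Proof.
elim: k => [|k IHk] //; rewrite expgS IHk; congr (_, _).
by rewrite /= /dih_act /= mul1r -natr1 addrC.
Qed.

(** The product [t * s] is the translation by 1; its powers are all translations, and these times
    [s] are all reflections. *)
Lemma dih_gen : <<[set s; t]>> = [set: dih n].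
Proof.
have sG : s \in <<[set s; t]>> by rewrite mem_gen ?set21.
have tG : t \in <<[set s; t]>> by rewrite mem_gen ?set22.
have rG c : ((c, false) : dih n) \in <<[set s; t]>>.
  rewrite -[c](natr_Zp c) -(dih_rotationX c) groupX //.
  have -> : ((1%R, false) : dih n) = t * s.
    by congr (_, _); rewrite /= /dih_act /= mulN1r oppr0 addr0.
  exact: groupM.
apply/setP => -[c []]; rewrite [RHS]inE; last exact: rG.
have -> : ((c, true) : dih n) = ((c, false) : dih n) * s.
  by congr (_, _); rewrite /= /dih_act /= mulr0 addr0.
exact: groupM.
Qed.

(** Two distinct involutions generate a dihedral group, and its order determines it. *)
Lemma dihedral_isog : [set: dih n] \isog [set: 'D_(2 * n)].
Proof.
have st : s != t by rewrite xpair_eqE negb_and eq_sym oner_eq0.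
have := involutions_gen_dihedral (dih_reflection_order _) (dih_reflection_order _) st.
by rewrite dih_gen cardsT card_prod card_ord card_bool Zp_cast // mulnC.
Qed.

Lemma dihedral_hom : exists f : 'D_(2 * n) -> dih n,
  bijective f /\ {morph f : x y / x * y}.
Proof.
have := dihedral_isog; rewrite isog_sym => /isogP[f injf imf].
have fi : injective f by move=> x y; apply: (injmP injf).
exists f; split; last by move=> x y; rewrite morphM ?inE.
apply: inj_card_bij => //.
by rewrite -!cardsT -imf card_injm.
Qed.

End DihedralIso.

(** * Semidirect products from a section of a group extension *)

Section SplitExtension.
Local Open Scope group_scope.
Variables (H G : groupType) (P : {pred G}) (N : subGroupType P) (s : H -> G).
Hypotheses (sM : {morph s : a b / a * b})
  (norm_s : forall a x, x \in P -> s a * x * (s a)^-1 \in P)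
  (cap_s : forall a, s a \in P -> a = 1)
  (cover_s : forall g, exists a, g * (s a)^-1 \in P).

Let s1 : s 1 = 1.
Proof. by apply: (mulgI (s 1)); rewrite -sM !mulg1. Qed.

Let sV a : s a^-1 = (s a)^-1.
Proof. by apply: (mulgI (s a)); rewrite -sM !mulgV. Qed.

Definition split_act (a : H) (x : N) : N :=
  @Sub G P N _ (norm_s a (valP x)).

Lemma val_split_act a x : val (split_act a x) = s a * val x * (s a)^-1.
Proof. exact: SubK. Qed.

Fact split_act1 x : split_act 1 x = x.
Proof. by apply: val_inj; rewrite val_split_act s1 invg1 mul1g mulg1. Qed.

Fact split_actM a b x : split_act (a * b) x = split_act a (split_act b x).
Proof. by apply: val_inj; rewrite !val_split_act sM invgM !mulgA. Qed.

Fact split_act_morph a : {morph split_act a : x y / x * y}.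
Proof.
by move=> x y; apply: val_inj; rewrite valM !val_split_act valM !mulgA mulgVK.
Qed.

Definition split_action : auto_action H N :=
  AutAction split_act1 split_actM split_act_morph.

Definition split_map (u : sdprod_of split_action) : G := val u.2 * s u.1.

Fact split_map_morph : {morph split_map : u v / u * v}.
Proof.
move=> u v; rewrite /split_map /= valM val_split_act sM !mulgA.
by rewrite mulgVK.
Qed.
HB.instance Definition _ := isMultiplicative.Build _ _ split_map split_map_morph.

(** Every g factors as (g (s a)^-1) (s a) with [a] supplied by [cover_s]; [cap_s] makes [a]
    unique. *)
Lemma split_map_bij : bijective split_map.
Proof.
pose c g : H := sval (cid (cover_s g)).
have cP g : g * (s (c g))^-1 \in P by rewrite /c; case: cid.
exists (fun g => (c g, @Sub G P N _ (cP g)) : sdprod_of split_action); last first.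
  by move=> g; rewrite /split_map /= SubK mulgVK.
move=> [a x].
have ca : c (val x * s a) = a.
  apply/esym/divg1_eq/cap_s; rewrite sM sV.
  (* With c the index chosen for x s(a), the element y = x s(a) s(c)^-1 lies in P, hence so does
     x^-1 y = s(a) s(c)^-1 = s(a c^-1). *)
  pose y : N := @Sub G P N _ (cP (val x * s a)).
  have -> : s a * (s (c (val x * s a)))^-1 = val (x^-1 * y).
    by rewrite valM gmulfV SubK !mulgA mulVg mul1g.
  exact: valP.
by congr (_, _) => //; apply: val_inj; rewrite SubK /split_map /= ca mulgK.
Qed.

Lemma sdprod_of_split :
  exists (th : auto_action H N) (phi : {multiplicative sdprod_of th -> G}),
    bijective phi /\ forall x, phi (1, x) = val x.
Proof.
exists split_action, split_map; split; first exact: split_map_bij.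
by move=> x; rewrite /= /split_map /= s1 mulg1.
Qed.

End SplitExtension.

(** * Group actions on quivers, path algebras and preprojective algebras *)

Record quiver_action (H : groupType) (Q : quiver) := QuiverAction {
  vact : H -> qvert Q -> qvert Q;
  aact : H -> qarr Q -> qarr Q;
  vact1 : forall v, vact 1%g v = v;
  vactM : forall u w v, vact (u * w)%g v = vact u (vact w v);
  aact1 : forall a, aact 1%g a = a;
  aactM : forall u w a, aact (u * w)%g a = aact u (aact w a);
  qsrc_act : forall u a, qsrc (aact u a) = vact u (qsrc a);
  qtgt_act : forall u a, qtgt (aact u a) = vact u (qtgt a)
}.

Section PathAction.
Variables (H : groupType) (Q : quiver) (A : quiver_action H Q).

Lemma vactK u : cancel (vact A u) (vact A u^-1%g).
Proof. by move=> v; rewrite -vactM mulVg vact1. Qed.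

Fact path_act_subproof u (p : qpath Q) :
  is_path (vact A u (psrc p)) (map (aact A u) (parrs p)).
Proof.
case: p => -[v s] /=; rewrite /psrc /parrs /=.
elim: s v => //= a s IHs v /andP[/eqP <- /IHs].
by rewrite qsrc_act qtgt_act eqxx.
Qed.
Definition path_act u p : qpath Q :=
  exist _ (vact A u (psrc p), map (aact A u) (parrs p)) (path_act_subproof u p).

Lemma psrc_act u p : psrc (path_act u p) = vact A u (psrc p).
Proof. by []. Qed.

Lemma plen_act u p : plen (path_act u p) = plen p.
Proof. exact: size_map. Qed.

Lemma ptgt_act u p : ptgt (path_act u p) = vact A u (ptgt p).
Proof.
rewrite /ptgt psrc_act /= -map_comp -(last_map (vact A u)) -map_comp.
by congr last; apply: eq_map => a; exact: qtgt_act.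
Qed.

Lemma path_act1 p : path_act 1%g p = p.
Proof.
apply: val_inj; rewrite /= vact1 (eq_map (@aact1 _ _ A)) map_id.
by rewrite -surjective_pairing.
Qed.

Lemma path_actM u w p : path_act (u * w)%g p = path_act u (path_act w p).
Proof.
by apply: val_inj; rewrite /= vactM (eq_map (@aactM _ _ A u w)) map_comp.
Qed.

Lemma path_actK u : cancel (path_act u) (path_act u^-1%g).
Proof. by move=> p; rewrite -path_actM mulVg path_act1. Qed.

Lemma path_act_eq u p q : (path_act u p == q) = (p == path_act u^-1%g q).
Proof. by rewrite -{1}[q](path_actK u^-1%g) invgK (can_eq (path_actK u)). Qed.

Lemma pathcomp_act u p q :
  pathcomp (path_act u p) (path_act u q) = omap (path_act u) (pathcomp p q).
Proof.
have := pathcompP p q; have := pathcompP (path_act u p) (path_act u q).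
rewrite ptgt_act psrc_act (can_eq (vactK u)).
case: ifP => _; last by move=> -> ->.
move=> [r [-> vr _ _]] [t [-> vt _ _]]; congr Some; apply: val_inj.
by rewrite vr /= /psrc /parrs vt /= map_cat.
Qed.

Lemma path_act_triv u v : path_act u (ptriv v) = ptriv (vact A u v).
Proof. exact: val_inj. Qed.

Lemma path_act_arrow u a : path_act u (parrow a) = parrow (aact A u a).
Proof. by apply: val_inj; rewrite /= /psrc /= qsrc_act. Qed.

Section PathAlgebraAction.
Local Open Scope ring_scope.
Variable k : fieldType.
Local Notation kQ := (pathalg k Q).

Definition pathalg_act u (f : kQ) : kQ :=
  \sum_(p <- monalg.msupp f) coef p f *: pbase k (path_act u p).

(** This serves as the working definition of the action: linearity and the group laws are read off
    from coefficients, without handling supports. *)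
Lemma coef_act u f q : coef q (pathalg_act u f) = coef (path_act u^-1%g q) f.
Proof.
rewrite /pathalg_act [in RHS](pathalgE f) !linear_sum; apply: eq_bigr => p _.
by rewrite !linearZ /= !coef_base path_act_eq.
Qed.

Fact pathalg_act_linear u : linear (pathalg_act u).
Proof. by move=> c f g; apply/coefP => p; rewrite coef_act !linearP /= !coef_act. Qed.
HB.instance Definition _ u :=
  GRing.isLinear.Build k kQ kQ _ (pathalg_act u) (pathalg_act_linear u).

Lemma pathalg_act_base u p : pathalg_act u (pbase k p) = pbase k (path_act u p).
Proof.
by apply/coefP => q; rewrite coef_act !coef_base path_act_eq.
Qed.

Fact pathalg_act_monoid u : monoid_morphism (pathalg_act u).
Proof.
have actM f g : pathalg_act u (f * g) = pathalg_act u f * pathalg_act u g.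
  elim/pathalg_ind: f => [|c p f IHf]; first by rewrite mul0r !linear0 mul0r.
  rewrite mulrDl !linearD /= IHf mulrDl -scalerAl !linearZ /= -scalerAl.
  congr (_ *: _ + _).
  elim/pathalg_ind: g {IHf} => [|d q g IHg]; first by rewrite mulr0 !linear0 mulr0.
  rewrite mulrDr !linearD /= IHg mulrDr -scalerAr !linearZ /= -scalerAr.
  congr (_ *: _ + _); rewrite !pathalg_act_base !pbaseM pathcomp_act.
  by case: (pathcomp p q) => [r|] /=; rewrite ?linear0 ?pathalg_act_base.
(* A multiplicative map with 1 in its image fixes 1. *)
have e : pathalg_act u (pathalg_act u^-1%g 1) = 1.
  by apply/coefP => p; rewrite !coef_act path_actK.
by split=> //; rewrite -[LHS]mulr1 -[X in _ * X]e -actM mul1r.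
Qed.
HB.instance Definition _ u :=
  GRing.isMonoidMorphism.Build kQ kQ (pathalg_act u) (pathalg_act_monoid u).

Lemma pathalg_act1 f : pathalg_act 1%g f = f.
Proof. by apply/coefP => p; rewrite coef_act invg1 path_act1. Qed.

Lemma pathalg_actM u w f : pathalg_act (u * w)%g f = pathalg_act u (pathalg_act w f).
Proof. by apply/coefP => p; rewrite !coef_act invgM path_actM. Qed.

End PathAlgebraAction.
End PathAction.

Section PreprojectiveAction.
Local Open Scope ring_scope.
Variables (H : groupType) (Q : quiver) (A : quiver_action H (double_quiver Q)).
Variables (k : fieldType) (chi : H -> k).
Hypothesis relA :
  forall u, pathalg_act A u (preproj_rel k Q) = chi u *: preproj_rel k Q.

(** The relation need only be preserved up to a scalar, which is absorbed into the left cofactor;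
    reflections produce the scalar -1. *)
Lemma preproj_ideal_act u f :
  f \in @preproj_ideal k Q -> pathalg_act A u f \in @preproj_ideal k Q.
Proof.
move=> /preproj_idealP[s ->]; apply/preproj_idealP.
exists [seq (chi u *: pathalg_act A u fg.1, pathalg_act A u fg.2) | fg <- s].
rewrite big_map linear_sum; apply: eq_bigr => fg _.
by rewrite !rmorphM /= relA -!scalerAl -scalerAr scalerAl.
Qed.

Definition preproj_act u (x : preproj k Q) : preproj k Q :=
  preproj_pi (pathalg_act A u (repr x)).

Lemma preproj_actE u f :
  preproj_act u (preproj_pi f) = preproj_pi (pathalg_act A u f).
Proof.
apply/preproj_piP; rewrite -raddfB; apply: preproj_ideal_act.
by apply/preproj_piP; rewrite preproj_piK.
Qed.

Lemma preproj_actM u w x : preproj_act (u * w)%g x = preproj_act u (preproj_act w x).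
Proof. by elim/preproj_ind: x => f; rewrite !preproj_actE pathalg_actM. Qed.

Lemma preproj_actK u : cancel (preproj_act u) (preproj_act u^-1%g).
Proof.
move=> x; rewrite -preproj_actM mulVg.
by elim/preproj_ind: x => f; rewrite preproj_actE pathalg_act1.
Qed.

Lemma preproj_act_homog u j x :
  homog_part j x -> homog_part j (preproj_act u x).
Proof.
move=> [f fj ->]; rewrite preproj_actE; exists (pathalg_act A u f) => //.
move=> p; apply: contraTeq => pj.
rewrite -monalg.mcoeff_eq0; apply/eqP/(etrans (coef_act A u f p)).
apply: coef_outdom; apply: contra pj => /fj.
by rewrite plen_act => ->.
Qed.

Fact preproj_act_graut u : `[< is_graut (preproj_act u) >].
Proof.
apply/asboolP; split.
- move=> c x y; elim/preproj_ind: x => f; elim/preproj_ind: y => g.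
  by rewrite -linearP !preproj_actE !linearP.
- split=> [|x y]; first by rewrite -[1]/(preproj_pi 1) preproj_actE rmorph1.
  elim/preproj_ind: x => f; elim/preproj_ind: y => g.
  by rewrite -preproj_pi_mul !preproj_actE rmorphM preproj_pi_mul.
- exists (preproj_act u^-1%g); first exact: preproj_actK.
  by move=> x; rewrite -{2}[x](preproj_actK u^-1%g) invgK.
- move=> j; apply/seteqP; split=> [_ [x xj <-]|x xj]; first exact: preproj_act_homog.
  exists (preproj_act u^-1%g x); first exact: preproj_act_homog.
  by rewrite -{1}[u]invgK preproj_actK.
Qed.
Definition graut_act u : graut k Q := exist _ (preproj_act u) (preproj_act_graut u).

Lemma graut_actM : {morph graut_act : u w / (u * w)%g}.
Proof. by move=> u w; apply: val_inj; apply/funext => x; exact: preproj_actM. Qed.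

Lemma graut_act_videm u v : val (graut_act u) (@videm k Q v) = @videm k Q (vact A u v).
Proof. by rewrite /= preproj_actE pathalg_act_base path_act_triv. Qed.

End PreprojectiveAction.

(** * Path length, and the preprojective algebra in degrees 0 and 1 *)

Section PathDegree.
Local Open Scope ring_scope.
Variables (k : fieldType) (Q : quiver).
Local Notation kQ := (pathalg k Q).

Lemma plen_pathcomp (p q r : qpath Q) :
  pathcomp p q = Some r -> plen r = (plen p + plen q)%N.
Proof.
have := pathcompP p q; case: ifP => [_ [t [-> vt _ _]] [<-]|_ -> //].
by rewrite /plen {1}/parrs vt size_cat.
Qed.

Lemma plen1P (p : qpath Q) : plen p = 1%N -> exists a, p = parrow a.
Proof.
case: p => -[v [|a [|b s]]] //= pP _; exists a; apply: val_inj => /=.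
by case/andP: pP => /eqP ->.
Qed.

Lemma plen0P (p : qpath Q) : plen p = 0%N -> exists v, p = ptriv v.
Proof. by case: p => -[v [|a s]] //= pP _; exists v; apply: val_inj. Qed.

Lemma coefM_neq0 (f g : kQ) r : coef r (f * g) != 0 ->
  exists p q, [/\ coef p f != 0, coef q g != 0 & pathcomp p q = Some r].
Proof.
move=> fgr; apply: contrapT => none; case/eqP: fgr.
rewrite (pathalgE f) (pathalgE g) mulr_suml linear_sum big1 //= => p _.
rewrite mulr_sumr linear_sum big1 //= => q _.
rewrite -scalerAl -scalerAr !linearZ /= pbaseM.
have [->|fp] := eqVneq (coef p f) 0; first by rewrite mul0r.
have [->|gq] := eqVneq (coef q g) 0; first by rewrite mul0r mulr0.
case e: (pathcomp p q) => [t|]; last by rewrite linear0 !mulr0.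
rewrite coef_base; case: eqP => [tr|]; last by rewrite !mulr0.
by case: none; exists p, q; rewrite e tr.
Qed.

(** This is membership in the m-th power of the ideal spanned by the non-trivial paths. *)
Definition order_ge m (f : kQ) := forall p, coef p f != 0 -> (m <= plen p)%N.

Lemma order_geM a b f g : order_ge a f -> order_ge b g -> order_ge (a + b) (f * g).
Proof.
move=> fa gb r /coefM_neq0 [p [q [/fa pa /gb qb /plen_pathcomp ->]]].
exact: leq_add.
Qed.

Lemma order_geD m f g : order_ge m f -> order_ge m g -> order_ge m (f + g).
Proof.
move=> fm gm p; rewrite linearD /=.
have [->|fp _] := eqVneq (coef p f) 0; last exact: fm.
by rewrite add0r => /gm.
Qed.

Lemma order_ge_sum m (I : Type) (s : seq I) (F : I -> kQ) :
  (forall i, order_ge m (F i)) -> order_ge m (\sum_(i <- s) F i).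
Proof.
move=> Fm; elim/big_rec: _ => [p|i f _]; first by rewrite linear0 eqxx.
exact: order_geD.
Qed.

Lemma order_ge_arrow a : order_ge 1 (pbase k (parrow a)).
Proof. by move=> p; rewrite coef_base; case: (_ =P p) => [<-|]; rewrite ?eqxx. Qed.

End PathDegree.

Section LowDegree.
Local Open Scope ring_scope.
Variables (k : fieldType) (Q : quiver).
Local Notation A := (preproj k Q).
Local Notation QQ := (double_quiver Q).

Lemma order_ge_preproj_rel : order_ge 2 (preproj_rel k Q).
Proof.
rewrite /preproj_rel -sumrN -big_split -[2%N]/(1 + 1)%N /=.
apply: order_ge_sum => a; apply: order_geD; last move=> p.
  by apply: order_geM; apply: order_ge_arrow.
rewrite linearN oppr_eq0; move: p.
by apply: order_geM; apply: order_ge_arrow.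
Qed.

(** The generator has order at least 2, and multiplication cannot lower the order. Hence
    coefficients at vertices and arrows are well defined on the quotient. *)
Lemma coef_preproj_ideal f (p : qpath QQ) :
  f \in @preproj_ideal k Q -> (plen p < 2)%N -> coef p f = 0.
Proof.
move=> /preproj_idealP[s ->] p2; apply/eqP; apply: contraLR p2; rewrite -leqNgt.
move: p; apply: order_ge_sum => uv.
rewrite -[2%N]addn0; apply: order_geM => //.
by rewrite -[2%N]add0n; apply: order_geM => //; exact: order_ge_preproj_rel.
Qed.

(** The character of A dual to e_v; by [vertex_charE] the choice of representative is immaterial. *)
Definition vertex_char v (x : A) : k := coef (@ptriv QQ v) (repr x).

Lemma vertex_charE v f : vertex_char v (preproj_pi f) = coef (ptriv v) f.
Proof.
apply/eqP; rewrite -subr_eq0 -linearB; apply/eqP/coef_preproj_ideal => //.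
by apply/preproj_piP; rewrite preproj_piK.
Qed.

Fact vertex_char_linear v : linear_for *%R (vertex_char v).
Proof.
move=> c x y; elim/preproj_ind: x => f; elim/preproj_ind: y => g.
by rewrite -linearP !vertex_charE linearP.
Qed.
HB.instance Definition _ v :=
  GRing.isLinear.Build k A k _ (vertex_char v) (vertex_char_linear v).

Fact vertex_char_monoid v : monoid_morphism (vertex_char v).
Proof.
split=> [|x y]; first by rewrite -[1]/(preproj_pi 1) vertex_charE coef_one_triv.
elim/preproj_ind: x => f; elim/preproj_ind: y => g.
by rewrite -preproj_pi_mul !vertex_charE coefM_triv.
Qed.
HB.instance Definition _ v :=
  GRing.isMonoidMorphism.Build A k (vertex_char v) (vertex_char_monoid v).

Lemma vertex_char_videm v w : vertex_char v (videm k w) = (v == w)%:R.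
Proof.
rewrite vertex_charE coef_base; congr (_%:R); congr nat_of_bool.
by apply/eqP/eqP => [/(congr1 val) [->]|->].
Qed.

Lemma videm_inj : injective (@videm k Q).
Proof.
move=> v w /(congr1 (vertex_char v)); rewrite !vertex_char_videm eqxx.
by case: eqP => // _ /eqP; rewrite oner_eq0.
Qed.

Lemma videm_neq0 v : @videm k Q v != 0.
Proof.
apply/eqP => /(congr1 (vertex_char v)); rewrite vertex_char_videm eqxx linear0.
by move/eqP; rewrite oner_eq0.
Qed.

Lemma videmM v w : @videm k Q v * videm k w = if v == w then videm k v else 0.
Proof.
rewrite -preproj_pi_mul pbaseM pathcomp1p -[psrc _]/w.
by case: eqP => [->|_] //; rewrite linear0.
Qed.

Lemma sum_videm : \sum_v @videm k Q v = 1.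
Proof.
rewrite -[1]/(preproj_pi 1) -[RHS in _ = preproj_pi RHS]/(pathalg_one k QQ).
by rewrite pathalg_one.unlock linear_sum.
Qed.

Lemma homog_videm v : homog_part 0 (@videm k Q v).
Proof.
exists (pbase k (@ptriv QQ v)) => // p; rewrite -monalg.mcoeff_neq0.
rewrite -[monalg.mcoeff _ _]/(coef _ _) coef_base.
by case: (_ =P p) => [<-|]; rewrite ?eqxx.
Qed.

Lemma homog0_videm x : homog_part 0 x -> x = \sum_v vertex_char v x *: @videm k Q v.
Proof.
move=> [f f0 ->]; pose e v := @pbase k QQ (ptriv v).
have fE : f = \sum_v coef (ptriv v) f *: e v.
  apply/coefP => q; rewrite linear_sum /=.
  have [q0|q0] := eqVneq (plen q) 0%N.
    have [w ->] := plen0P q0; rewrite (bigD1 w) //= linearZ /= coef_base eqxx mulr1.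
    rewrite big1 ?addr0 // => v vw; rewrite linearZ /= coef_base.
    by case: (_ =P ptriv w) vw => [[->]|_ _]; rewrite ?eqxx ?mulr0.
  rewrite coef_outdom ?big1 //; last by apply: contra q0 => /f0 ->.
  move=> v _; rewrite linearZ /= coef_base.
  by case: (_ =P q) q0 => [<-|_ _]; rewrite ?mulr0.
rewrite [in LHS]fE linear_sum; apply: eq_bigr => v _.
by rewrite linearZ vertex_charE.
Qed.

Lemma homog_arrow (b : qarr QQ) :
  homog_part 1 (preproj_pi (pbase k (parrow b)) : A).
Proof.
exists (pbase k (parrow b)) => // p; rewrite -monalg.mcoeff_neq0.
rewrite -[monalg.mcoeff _ _]/(coef _ _) coef_base.
by case: (_ =P p) => [<-|]; rewrite ?eqxx.
Qed.

Lemma arrow_neq0 (b : qarr QQ) : (preproj_pi (pbase k (parrow b)) : A) != 0.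
Proof.
apply/eqP; rewrite -[0](linear0 (@preproj_pi k Q)) => /preproj_piP.
rewrite subr0 => /(@coef_preproj_ideal _ (parrow b))/(_ isT)/eqP.
by rewrite coef_base eqxx oner_eq0.
Qed.

Lemma arrow_videm (b : qarr QQ) (x := preproj_pi (pbase k (parrow b)) : A) :
  videm k (qsrc b : qvert Q) * x * videm k (qtgt b : qvert Q) = x.
Proof.
rewrite -!preproj_pi_mul pbaseM pathcomp1p eqxx pbaseM pathcompp1.
by rewrite -[ptgt _]/(qtgt b) eqxx.
Qed.

Lemma homog1_arrow x v w : homog_part 1 x ->
  @videm k Q v * x * videm k w != 0 ->
  exists b : qarr QQ, qsrc b = v /\ qtgt b = w.
Proof.
move=> [f f1 ->]; rewrite -!preproj_pi_mul; move=> fvw.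
apply: contrapT => none; case/eqP: fvw.
rewrite (pathalgE f) mulr_sumr mulr_suml big1_seq ?linear0 // => p /andP[_ /f1].
move/plen1P=> [b ->]; rewrite -scalerAr -scalerAl pbaseM pathcomp1p.
case: eqP => [vb|_]; last by rewrite mul0r scaler0.
rewrite pbaseM pathcompp1; case: eqP => [bw|_]; last by rewrite scaler0.
by case: none; exists b.
Qed.

End LowDegree.

(** * Graded automorphisms permute the vertices and preserve adjacency *)

Section GradedAutomorphisms.
Local Open Scope ring_scope.
Variables (k : fieldType) (Q : quiver) (g : graut k Q).
Local Notation QQ := (double_quiver Q).

(** A named copy of the underlying map, to which the linear and multiplicative structures are
    attached. *)
Definition graut_fun : preproj k Q -> preproj k Q := val g.
Local Notation gm := graut_fun.

Fact graut_fun_linear : linear gm. Proof. by have [] := grautP g. Qed.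
Fact graut_fun_monoid : monoid_morphism gm. Proof. by have [] := grautP g. Qed.
HB.instance Definition _ :=
  GRing.isLinear.Build k (preproj k Q) (preproj k Q) _ gm graut_fun_linear.
HB.instance Definition _ :=
  GRing.isMonoidMorphism.Build (preproj k Q) (preproj k Q) gm graut_fun_monoid.

Lemma graut_fun_neq0 x : x != 0 -> gm x != 0.
Proof.
have [_ _ /bij_inj gi _] := grautP g.
by apply: contra_neq => gx0; apply: gi; rewrite [LHS]gx0 [RHS](linear0 gm).
Qed.

Lemma graut_fun_homog j x : homog_part j x -> homog_part j (gm x).
Proof. by move=> xj; have [_ _ _ <-] := grautP g; exists x. Qed.

(** The character of v composed with g takes the orthogonal idempotents e_w, which sum to 1, to
    orthogonal idempotents of the field k. So it is 1 at exactly one vertex [t v] and 0 elsewhere,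
    and g(e_w) is the sum of the e_v with [t v = w]. *)
Lemma graut_vertex_perm : exists s : qvert Q -> qvert Q,
  injective s /\ forall v, gm (videm k v) = videm k (s v).
Proof.
have /choice[t tE] (v : qvert Q) : exists w, vertex_char v (gm (videm k w)) != 0.
  apply: contrapT => none; have := oner_neq0 k.
  rewrite -(rmorph1 (vertex_char v)) -(rmorph1 gm) -sum_videm !rmorph_sum big1 ?eqxx //.
  by move=> w _; apply/eqP; apply: contrapT => /negP vw; case: none; exists w.
have charE (v : qvert Q) w : vertex_char v (gm (videm k w)) = (w == t v)%:R.
  have [->|wt] := eqVneq w (t v).
    apply: (mulfI (tE v)); rewrite -(rmorphM (vertex_char v)) -(rmorphM gm).
    by rewrite videmM eqxx mulr1.
  apply: (mulfI (tE v)); rewrite -(rmorphM (vertex_char v)) -(rmorphM gm).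
  by rewrite videmM eq_sym (negPf wt) mulr0 !rmorph0.
have gE w : gm (videm k w) = \sum_(v : qvert Q) (w == t v)%:R *: videm k v.
  rewrite [LHS]homog0_videm; first by apply: eq_bigr => v _; rewrite charE.
  exact/graut_fun_homog/homog_videm.
(* Since g(e_w) is non-zero, [t] is onto; on a finite set its section [s] is then a two-sided
   inverse. *)
have /choice[s sK] w : exists v, t v = w.
  apply: contrapT => none; have := graut_fun_neq0 (videm_neq0 k w).
  rewrite gE big1 ?eqxx // => v _; case: eqP => [e|]; last by rewrite scale0r.
  by case: none; exists v.
have si : injective s by exact: can_inj sK.
have tK : cancel t s by apply/(bij_can_sym (injF_bij si)).
exists s; split=> // w; rewrite gE (bigD1 (s w)) //= sK eqxx scale1r.
rewrite big1 ?addr0 // => v; rewrite -{1}[v]tK (inj_eq si) eq_sym => /negPf ->.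
by rewrite scale0r.
Qed.

(** The image of b under g is a non-zero element of degree 1 cut out by the idempotents at the
    images of its ends, so some arrow joins those vertices. *)
Lemma graut_arrow (s : qvert Q -> qvert Q) (b : qarr QQ) :
    (forall v, gm (videm k v) = videm k (s v)) ->
  exists c : qarr QQ, qsrc c = s (qsrc b) /\ qtgt c = s (qtgt b).
Proof.
move=> sE; apply: (homog1_arrow (graut_fun_homog (homog_arrow k b))).
rewrite -!sE -(rmorphM gm) -(rmorphM gm) arrow_videm; apply/graut_fun_neq0/arrow_neq0.
Qed.

End GradedAutomorphisms.

(** * The dihedral action on the cyclic quiver, and rigidity of the cycle *)

Section CyclicQuiver.
Local Open Scope ring_scope.
Variable n : nat.
Local Notation Q := (cyclic_quiver n).
Local Notation QQ := (double_quiver Q).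

(* A reflection sends i -> i+1 to the arrow opposite to c-i-1 -> c-i, hence   *)
(* the shift of the index by 1.                                               *)
Definition dih_aact (u : dih n) (b : 'Z_n + 'Z_n) : 'Z_n + 'Z_n :=
  match b with
  | inl i => if u.2 then inr (dih_act u i - 1) else inl (dih_act u i)
  | inr i => if u.2 then inl (dih_act u i - 1) else inr (dih_act u i)
  end.

Fact dih_aact1 b : dih_aact 1%g b = b.
Proof. by case: b => i; rewrite /= dih_act1. Qed.

Fact dih_aactM u w b : dih_aact (u * w)%g b = dih_aact u (dih_aact w b).
Proof.
case: u w b => c [] [d []] [] i; rewrite /= /dih_act /= /dih_act /=;
by congr (_ _); ring.
Qed.

Fact dih_qsrc u b : @qsrc QQ (dih_aact u b) = dih_act u (@qsrc QQ b).
Proof. by case: u b => c [] [] i; rewrite /= /dih_act /=; ring. Qed.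

Fact dih_qtgt u b : @qtgt QQ (dih_aact u b) = dih_act u (@qtgt QQ b).
Proof. by case: u b => c [] [] i; rewrite /= /dih_act /=; ring. Qed.

Definition dih_action : quiver_action (dih n) QQ :=
  @QuiverAction (dih n) QQ (@dih_act n) dih_aact
    (@dih_act1 n) (@dih_actM n) dih_aact1 dih_aactM dih_qsrc dih_qtgt.

Lemma dih_act_inj u : injective (@dih_act n u).
Proof. exact: can_inj (vactK dih_action u). Qed.

(** Rotations permute the terms within each of the two sums of the relation; reflections exchange
    the two sums, whence the sign. *)
Lemma dih_preproj_rel (k : fieldType) u :
  pathalg_act dih_action u (preproj_rel k Q) = (-1) ^+ u.2 *: preproj_rel k Q.
Proof.
rewrite /preproj_rel rmorphB !rmorph_sum /=.
have actE (i : 'Z_n) : pathalg_act dih_action u (darrow k (i : qarr Q)) =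
    pbase k (@parrow QQ (dih_aact u (inl i))).
  by rewrite pathalg_act_base path_act_arrow.
have actsE (i : 'Z_n) : pathalg_act dih_action u (darrow_star k (i : qarr Q)) =
    pbase k (@parrow QQ (dih_aact u (inr i))).
  by rewrite pathalg_act_base path_act_arrow.
under eq_bigr do rewrite rmorphM /= actE actsE.
under [X in _ - X]eq_bigr do rewrite rmorphM /= actE actsE.
rewrite /=; case: (u.2); last first.
  rewrite scale1r; congr (_ - _);
  by rewrite [RHS](reindex_inj (@dih_act_inj u)).
rewrite scaleN1r opprB.
have si : injective (fun i => dih_act u i - 1).
  by move=> i j /addIr/dih_act_inj.
by congr (_ - _); rewrite [RHS](reindex_inj si).
Qed.

Hypothesis n_ge3 : (3 <= n)%N.

(** For n = 2 this fails: the steps +1 and -1 coincide, so a reflection can act trivially on the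
    vertices. *)
Lemma Zn_two_neq0 : 1 + 1 != 0 :> 'Z_n.
Proof.
apply/eqP => /(congr1 (@nat_of_ord _)).
have := val_Zp_nat (ltnW n_ge3) 2; by rewrite modn_small // => ->.
Qed.

Lemma dih_act_faithful (u : dih n) : (forall v, dih_act u v = v) -> u = 1%g.
Proof.
case: u => c e H.
have c0 : c = 0 by have := H 0; rewrite /dih_act /= mulr0 addr0.
have := H 1; rewrite /dih_act /= mulr1 {H}c0 add0r; case: e => //= /eqP.
by rewrite eq_sym -subr_eq0 opprK (negPf Zn_two_neq0).
Qed.

Lemma double_cyclic_arrow (b : qarr QQ) :
  qtgt b = qsrc b + 1 :> 'Z_n \/ qtgt b = qsrc b - 1 :> 'Z_n.
Proof. by case: b => i /=; [left | right; rewrite addrK]. Qed.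

(* Injectivity forbids s (v + 2) = s v, so all steps go the same way. *)
Lemma cyclic_rigid (s : 'Z_n -> 'Z_n) : injective s ->
    (forall v, s (v + 1) = s v + 1 \/ s (v + 1) = s v - 1) ->
  exists u : dih n, s =1 dih_act u.
Proof.
move=> si step.
have no_turn v : s (v + 1 + 1) <> s v.
  move/si/eqP; rewrite -subr_eq0.
  have -> : v + 1 + 1 - v = 1 + 1 by ring.
  by rewrite (negPf Zn_two_neq0).
have [e se] : exists e : bool, forall m : nat, s m%:R = s 0 + (-1) ^+ e * m%:R.
  (* The first step fixes the direction; [next] shows by induction that every later step repeats
     it. *)
  pose e := s 1 != s 0 + 1; exists e.
  have next m : s m.+1%:R = s m%:R + (-1) ^+ e.
    elim: m => [|m IHm].
      rewrite /e; case: eqP => [->|] //= ne.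
      by have := step 0; rewrite add0r => -[].
    have := no_turn m%:R; have := step m.+1%:R; rewrite !natr1 IHm.
    by case: (e) => /= -[-> | ->]; rewrite ?expr1 ?expr0 ?subrK ?addrK.
  elim=> [|m IHm]; first by rewrite mulr0 addr0.
  by rewrite next IHm -natr1; ring.
by exists (s 0, e) => v; rewrite -[v in LHS]natr_Zp se natr_Zp.
Qed.

End CyclicQuiver.

Theorem mainTheorem5 (k : closedFieldType) (char_k : [pchar k]%R =i pred0)
    (n : nat) (n_ge3 : (3 <= n)%N) :
  exists (th : auto_action 'D_(2 * n) (idem_stab k (cyclic_quiver n)))
         (phi : {multiplicative sdprod_of th -> graut k (cyclic_quiver n)}),
    bijective phi /\
    forall g : idem_stab k (cyclic_quiver n), phi (1%g, g) = \val g.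
Proof.
have [f [[f' fK f'K] fM]] := dihedral_hom (ltnW n_ge3).
pose Q := cyclic_quiver n; pose e : 'Z_n -> preproj k Q := @videm k Q.
(* The section of the extension: a dihedral element acts on A through its affine map. *)
pose s a := graut_act (@dih_preproj_rel n k) (f a).
have sM : {morph s : a b / (a * b)%g} by move=> a b; rewrite /s fM graut_actM.
have e_inj : injective e by exact: (@videm_inj k Q).
have sE a v : val (s a) (e v) = e (dih_act (f a) v).
  exact: graut_act_videm.
have s1 : s 1%g = 1%g by apply: (mulgI (s 1%g)); rewrite -sM !mulg1.
have sV a : (s a)^-1%g = s a^-1%g.
  by apply: (mulgI (s a)); rewrite -sM !mulgV s1.
have sK a v : dih_act (f a) (dih_act (f a^-1%g) v) = v.
  by apply: e_inj; rewrite -!sE -[LHS]/(val (s a * s a^-1)%g _) -sM mulgV s1.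
apply: (@sdprod_of_split _ _ _ _ s) => //.
- move=> a x /asboolP xP; apply/asboolP => v.
  rewrite sV -[LHS]/(val (s a) (val x (val (s a^-1%g) (e v)))).
  by rewrite sE xP sE sK.
- move=> a /asboolP sa; apply: (can_inj fK).
  have -> : f 1%g = 1%g by apply: (mulgI (f 1%g)); rewrite -fM !mulg1.
  by apply: (dih_act_faithful n_ge3) => v; apply: e_inj; rewrite -sE.
move=> g; have [p [pi gE]] := graut_vertex_perm g.
have [|u pE] := cyclic_rigid n_ge3 pi.
  (* The image of the arrow from v to v + 1 makes [p v] and [p (v + 1)] adjacent. *)
  move=> v; have [c [c1 c2]] := graut_arrow (inl v : qarr (double_quiver Q)) gE.
  by have := double_cyclic_arrow c; rewrite c1 c2.
(* Both g and [s (f' u)] induce the affine map [u] on the vertices, so their quotient fixes every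
   e_v. *)
exists (f' u); apply/asboolP => v.
rewrite sV -[LHS]/(val g (val (s (f' u)^-1%g) (e v))) sE.
by rewrite [LHS]gE pE -{1}[u]f'K sK.
Qed.
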